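(* Let $\mathcal{M}=(S,d)$ be any metric space and fix $\epsilon>0$. Consider the online algorithm $\mathrm{ALG\text{-}B}(\epsilon)$ for the Minimum-Cost Bipartite Perfect Matching with Delays problem on $\mathcal{M}$. Then $\mathrm{ALG\text{-}B}(\epsilon)$ is $O\!\left(\frac{1}{\epsilon}\, m^{\log_2\left(\frac{3+\epsilon}{2}\right)}\right)$-competitive, where $m$ is the number of requests in the instance.
   Context: Minimum-Cost Bipartite Perfect Matching with Delays (MBPMD): a metric space $(S,d)$ is given. An instance is a sequence of $m$ requests (unknown in advance to the algorithm); each request $r$ has a location $x(r)\in S$, an arrival time $t(r)\in\mathbb{R}$, and a class $\mathrm{class}(r)\in\{1,2\}$, and is revealed to the online algorithm at time $t(r)$ together with its distances to all previously revealed requests. The algorithm must produce, in real time, a perfect matching of the requests in which every matched pair consists of two requests of different classes: two not-yet-matched requests $p,q$ with $\mathrm{class}(p)\ne\mathrm{class}(q)$ may be matched at any time $t\ge\max(t(p),t(q))$. If pairs $(p_i,q_i)$ are matched at times $t_i$, the cost is $\sum_i \big(d(x(p_i),x(q_i)) + |t_i-t(p_i)|+|t_i-t(q_i)|\big)$. $\mathrm{OPT}$ is the minimum such cost over all admissible perfect matchings and matching times. An algorithm is $\alpha$-competitive if on every instance its cost is at most $\alpha\cdot\mathrm{OPT}$. Time-augmented metric: $D(p,q)=d(x(p),x(q))+|t(p)-t(q)|$ for requests $p,q$. Algorithm $\mathrm{ALG\text{-}B}(\epsilon)$, $\epsilon>0$: at every moment $t$, for every ordered pair of distinct currently unmatched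 (already arrived) requests $p,q$ with $t(p)\ge t(q)$ and $\mathrm{class}(p)\ne\mathrm{class}(q)$, if $t=t(p)+D(p,q)/\epsilon$ then $p,q$ are matched at time $t$. Ties are broken arbitrarily. $\log$ denotes $\log_2$. *)

(* Defs.v *)
From mathcomp Require Import all_boot all_order all_algebra.
From mathcomp Require Import all_classical all_reals all_analysis.

Set Implicit Arguments.
Unset Strict Implicit.
Unset Printing Implicit Defensive.

Import Order.TTheory GRing.Theory Num.Theory.
Local Open Scope classical_set_scope.
Local Open Scope ring_scope.

Definition log2 (R : realType) (x : R) : R := ln x / ln 2.

(* The Booleans stand for the two classes 1 and 2. *)
Record request (R : realType) (S : metricType R) := Request {
  loc : S;
  arrival : R;
  cls : bool
}.

Definition instance (R : realType) (S : metricType R) (m : nat) :=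
  'I_m -> request S.

(* The event (p, q, t) says that requests p and q are matched at time t. *)
Definition event (R : realType) (m : nat) : Type := ('I_m * 'I_m * R)%type.

Definition endpoints (R : realType) (m : nat) (e : event R m) : seq 'I_m :=
  [:: e.1.1; e.1.2].

(* A (possibly partial) matching with matching times, as the list of its
   events; the order of the list carries no meaning. *)
Definition schedule (R : realType) (m : nat) : Type := seq (event R m).

Definition all_endpoints (R : realType) (m : nat) (s : schedule R m) :
  seq 'I_m := flatten [seq endpoints e | e <- s].

Section MBPMD.
Context (R : realType) (S : metricType R).

Section Instance.
Context (m : nat) (I : instance S m).

Definition valid_event (e : event R m) : bool :=
  (cls (I e.1.1) != cls (I e.1.2)) &&
  (Num.max (arrival (I e.1.1)) (arrival (I e.1.2)) <= e.2).

(* Perfect: every request is an endpoint of exactly one event, and it occurs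
   there once. *)
Definition admissible : set (schedule R m) :=
  [set s | perm_eq (all_endpoints s) (enum 'I_m) /\ all valid_event s].

Definition event_cost (e : event R m) : R :=
  mdist (loc (I e.1.1)) (loc (I e.1.2))
  + `|e.2 - arrival (I e.1.1)| + `|e.2 - arrival (I e.1.2)|.

Definition cost (s : schedule R m) : R := \sum_(e <- s) event_cost e.

(* A minimum whenever some schedule is admissible; otherwise it has the
   junk value [inf set0]. *)
Definition OPT : R := inf [set cost s | s in admissible].

Definition aug_dist (p q : 'I_m) : R :=
  mdist (loc (I p)) (loc (I q)) + `|arrival (I p) - arrival (I q)|.

(* No event of s before time t involves r. *)
Definition unmatched_before (s : schedule R m) (t : R) (r : 'I_m) : bool :=
  all (fun e => (r \in endpoints e) ==> (t <= e.2)) s.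

(* At moment t the rule of ALG-B applies to the ordered pair (p, q), when s
   records what has been matched before t. *)
Definition triggered (eps : R) (s : schedule R m) (t : R) (p q : 'I_m) : bool :=
  [&& p != q,
      unmatched_before s t p && unmatched_before s t q,
      arrival (I q) <= arrival (I p) <= t,
      cls (I p) != cls (I q) &
      t == arrival (I p) + aug_dist p q / eps].

(* s is the complete trace of some execution of ALG-B(eps).  Several pairs
   sharing a request may be triggered at the same moment t; the tie-breaking
   is arbitrary, so a triggered pair is either matched at t or loses one of
   its members to a competing pair matched at t. *)
Definition ALG_B_run (eps : R) (s : schedule R m) : Prop :=
  [/\ uniq (all_endpoints s),
      (forall e, e \in s -> triggered eps s e.2 e.1.1 e.1.2) &
      (forall t p q, triggered eps s t p q ->
         exists2 e, e \in s &
           e.2 = t /\ (p \in endpoints e \/ q \in endpoints e))].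

End Instance.

(* An algorithm relates an instance to all its possible outputs, one for each
   way of resolving ties.  It must have an output, and every output must be
   a perfect matching within the bound, which may depend on the number m of
   requests.  Only instances that possess a perfect matching are considered. *)
Definition competitive
    (alg : forall m, instance S m -> schedule R m -> Prop)
    (alpha : nat -> R) : Prop :=
  forall m (I : instance S m), admissible I !=set0 ->
    (exists s, alg m I s) /\
    (forall s, alg m I s ->
       admissible I s /\ cost I s <= alpha m * OPT I).

Definition ALG_B (eps : R) (m : nat) (I : instance S m) (s : schedule R m) :=
  ALG_B_run I eps s.

End MBPMD.
Arguments ALG_B {R} S eps m I s.

(* Main.v *)
(* An edge (p, q) matched by the algorithm is nearly greedy: if q' has another
   class than p and is matched no earlier, then D(p, q) <= (1 + eps) D(p, q'),
   for otherwise (p, q') would have been triggered first. Process these edges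
   in chronological order, starting from the edges of an arbitrary perfect
   matching. Removing (p, q) either closes an alternating cycle or replaces the
   two virtual edges (p, q'), (p', q) by a virtual edge (p', q') whose length is
   at most x + y + (1 + eps) min(x, y), x and y being the old lengths. As in the
   Reingold-Tarjan analysis of greedy matching, a virtual edge made of k original
   edges is at most k^(log2 ((3 + eps) / 2)) times longer than their total, which
   bounds the sum of D over the edges of the algorithm; the cost of the algorithm
   is 1 + 2 / eps times that sum. *)
Require Import Defs.
From mathcomp Require Import all_boot all_order all_algebra.
From mathcomp Require Import all_classical all_reals all_analysis.
From mathcomp Require Import ring lra.
Set Implicit Arguments.
Unset Strict Implicit.
Unset Printing Implicit Defensive.
Import Order.TTheory GRing.Theory Num.Theory.
Local Open Scope ring_scope.

(** * Inequalities between real powers *)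

Lemma two_powR_log2 (R : realType) (x : R) : 0 < x -> 2 `^ log2 x = x.
Proof.
move=> x0; rewrite /powR pnatr_eq0 /= /log2 -mulrA mulVf ?mulr1 ?lnK//.
by rewrite gt_eqF// ln_gt0// ltr1n.
Qed.

Lemma log2_ge0 (R : realType) (x : R) : 1 <= x -> 0 <= log2 x.
Proof. by move=> x1; rewrite divr_ge0// ln_ge0// ler1n. Qed.

(* Squaring reduces this to AM-GM for [x `^ al, y `^ al] and for [x, y]. *)
Lemma powR_harmonic_mean (R : realType) (al x y : R) : 0 <= al -> 0 < x -> 0 < y ->
  2 * 2 `^ al * (x `^ al * y `^ al) <= (x `^ al + y `^ al) * (x + y) `^ al.
Proof.
move=> al0 x0 y0.
have X0 := powR_gt0 al x0; have Y0 := powR_gt0 al y0.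
have Z0 := powR_gt0 al (addr_gt0 x0 y0).
have T0 : 0 < (2 : R) `^ al by rewrite powR_gt0.
have sq : (2 `^ al) ^+ 2 * (x `^ al * y `^ al) <= ((x + y) `^ al) ^+ 2.
  have xy0 : 0 <= x + y by rewrite addr_ge0 ?ltW.
  have [x_ge0 y_ge0] := (ltW x0, ltW y0).
  rewrite !expr2 -!powRM ?mulr_ge0//.
  by apply: ge0_ler_powR => //; rewrite ?nnegrE ?mulr_ge0//;
    have := sqr_ge0 (x - y); lra.
rewrite -(@ler_pXn2r _ 2)// ?nnegrE ?mulr_ge0 ?addr_ge0 ?powR_ge0//.
move: (x `^ al) (y `^ al) ((x + y) `^ al) (2 `^ al) X0 Y0 Z0 T0 sq.
move=> X Y Z T X0 Y0 Z0 T0 sq.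
have -> : (2 * T * (X * Y)) ^+ 2 = (4 * (X * Y)) * (T ^+ 2 * (X * Y)) by ring.
have := sqr_ge0 (X - Y); have XY0 : 0 <= X * Y by rewrite mulr_ge0 ?ltW.
rewrite exprMn => XY.
by apply: ler_pM => //; rewrite ?mulr_ge0 ?sqr_ge0//; lra.
Qed.

(** Suppose [X * A <= Y * B]. Since [Y <= Z], increasing [B] only helps, so the extreme case is
    [X * A = Y * B]. There the claim is the last hypothesis up to the factor [A / Y]. *)
Lemma merge_weights (R : realFieldType) (X Y Z T A B : R) :
  0 < X -> 0 < Y -> X <= Z -> Y <= Z -> 0 <= A -> 0 <= B ->
  2 * T * (X * Y) <= (X + Y) * Z ->
  X * A + Y * B + (2 * T - 2) * Num.min (X * A) (Y * B) <= Z * (A + B).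
Proof.
wlog le : X Y A B / X * A <= Y * B.
  move=> H X0 Y0 XZ YZ A0 B0 h; have [le|/ltW le] := leP (X * A) (Y * B).
    by have := H X Y A B le X0 Y0 XZ YZ A0 B0 h; rewrite min_l.
  have := H Y X B A le Y0 X0 YZ XZ B0 A0.
  by rewrite [Y * X]mulrC [Y + X]addrC [B + A]addrC min_l// [Y * B + _]addrC => /(_ h).
move=> X0 Y0 XZ YZ A0 B0 h; rewrite min_l//.
rewrite -(ler_pM2l Y0).
have h1 : (Z - Y) * (X * A) <= (Z - Y) * (Y * B) by rewrite ler_wpM2l// subr_ge0.
have h2 : A * (2 * T * (X * Y)) <= A * ((X + Y) * Z) by rewrite ler_wpM2l.
lra.
Qed.

(** The order of the list stands for chronological order, so nearly greedy matchings can be studied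
    without matching times. *)
Fixpoint greedy (R : realType) (A B : eqType) (D : A -> B -> R) (c : R)
    (L : seq (A * B)) : Prop :=
  if L is e :: L' then
    [/\ forall b, b \in unzip2 L -> D e.1 e.2 <= c * D e.1 b,
        forall a, a \in unzip1 L -> D e.1 e.2 <= c * D a e.2 &
        greedy D c L']
  else True.

(** * Total length of nearly greedy bipartite matchings *)

Section GreedyMatching.
Context (R : realType) (A B : eqType) (D : A -> B -> R) (al : R).
Context (al_ge0 : 0 <= al).
Context (D_quad : forall a b a' b', D a' b' <= D a' b + D a b + D a b').

Let c : R := 2 * 2 `^ al - 2.

Let c_ge0 : 0 <= c.
Proof.
rewrite subr_ge0 ler_peMr//; have := ler_powR (ler1n R 2) al_ge0.
by rewrite powRr0.
Qed.

(* A virtual edge [((a, b), (k, w))] stands for an alternating path from [a]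
   to [b] containing [k] original edges, of total length [w]. *)
Definition virtual_ok (f : A * B * (R * R)) :=
  [/\ 0 < f.2.1, 0 <= f.2.2 & D f.1.1 f.1.2 <= f.2.1 `^ al * f.2.2].

(* The second sum on the left is a potential: a merge raises it by at least the
   length of the removed edge, and closing a cycle releases it. *)
Lemma greedy_virtual_bound (L : seq (A * B)) (M : seq (A * B * (R * R))) (K : R) :
  perm_eq (unzip1 L) (unzip1 (unzip1 M)) ->
  perm_eq (unzip2 L) (unzip2 (unzip1 M)) ->
  greedy D c L -> (forall f, f \in M -> virtual_ok f) ->
  \sum_(f <- M) f.2.1 <= K ->
  \sum_(e <- L) D e.1 e.2 + \sum_(f <- M) f.2.1 `^ al * f.2.2 <=
    2 * K `^ al * \sum_(f <- M) f.2.2.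
Proof.
elim: L M => [|[a b] L IH] M.
  move=> /perm_size /=; rewrite !size_map; case: M => // _ _ _ _ _.
  by rewrite !big_nil mulr0 addr0.
move=> p1 p2 [ga gb gL] ok.
have : a \in unzip1 (unzip1 M) by rewrite -(perm_mem p1) mem_head.
move=> /mapP[_ /mapP[[[a1 b'] [k1 w1]] fM ->] /= ea]; subst a1.
have pM := perm_to_rem fM.
set f1 := (a, b', (k1, w1)) in fM pM *.
set M' := rem f1 M in pM *.
have ok1 : virtual_ok f1 by exact: ok.
have okM' f : f \in M' -> virtual_ok f.
  by move=> fM'; apply: ok; rewrite (perm_mem pM) inE fM' orbT.
have {}p1 : perm_eq (unzip1 L) (unzip1 (unzip1 M')).
  move: p1; rewrite (perm_sym _ (unzip1 (unzip1 M))).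
  rewrite (permPl (perm_map fst (perm_map fst pM))) perm_sym /=.
  by rewrite perm_cons.
have {}p2 : perm_eq (b :: unzip2 L) (b' :: unzip2 (unzip1 M')).
  move: p2; rewrite (perm_sym _ (unzip2 (unzip1 M))).
  by rewrite (permPl (perm_map snd (perm_map fst pM))) perm_sym.
rewrite !(perm_big _ pM) !big_cons /=.
have k_ge0 : 0 <= \sum_(f <- M') f.2.1.
  by rewrite big_seq sumr_ge0// => f /okM'[/ltW].
have w_ge0 : 0 <= \sum_(f <- M') f.2.2.
  by rewrite big_seq sumr_ge0// => f /okM'[].
case: ok1 => /= k1_gt0 w1_ge0 D1 sumK.
have leK x : 0 < x -> x <= K -> x `^ al <= K `^ al.
  move=> x0 xK; apply: ge0_ler_powR => //; rewrite nnegrE ltW//.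
  exact: lt_le_trans xK.
(* If [b' = b], removing [(a, b)] closes a cycle. The length [D a b] and the released potential are
   each at most the [al]-th power of [k1] times [w1], whence the factor 2 in the bound. *)
have [eb|neb] := eqVneq b' b.
  subst b'; move: p2; rewrite perm_cons => p2.
  have := IH M' p1 p2 gL okM'; have := leK k1 k1_gt0.
  have k1K : k1 <= K by lra.
  have sK : \sum_(f <- M') f.2.1 <= K by lra.
  move=> /(_ k1K) /(ler_wpM2r w1_ge0) ? /(_ sK) ?; lra.
have : b \in b' :: unzip2 (unzip1 M') by rewrite -(perm_mem p2) mem_head.
rewrite inE eq_sym (negbTE neb) /=.
move=> /mapP[_ /mapP[[[a' b1] [k2 w2]] gM ->] /= eb]; subst b1.
have pM' := perm_to_rem gM.
set f2 := (a', b, (k2, w2)) in gM pM' *.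
set M'' := rem f2 M' in pM' *.
have ok2 : virtual_ok f2 by exact: okM'.
have okM'' f : f \in M'' -> virtual_ok f.
  by move=> fM'; apply: okM'; rewrite (perm_mem pM') inE fM' orbT.
case: ok2 => /= k2_gt0 w2_ge0 D2.
pose g := (a', b', (k1 + k2, w1 + w2)).
have {}p2 : perm_eq (unzip2 L) (unzip2 (unzip1 (g :: M''))).
  have q : perm_eq (b' :: unzip2 (unzip1 M')) (b :: b' :: unzip2 (unzip1 M'')).
    apply: (@perm_trans _ (b' :: b :: unzip2 (unzip1 M''))).
      by rewrite perm_cons; exact: (perm_map snd (perm_map fst pM')).
    by rewrite (perm_catCA [:: b'] [:: b]).
  by have := perm_trans p2 q; rewrite perm_cons.
(* Both [b'] and [a'] are matched later in [L], so near-greediness bounds [D a b] by [c] times the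
   length of either virtual edge that disappears. *)
have b'L : b' \in unzip2 L by rewrite (perm_mem p2) mem_head.
have a'L : a' \in unzip1 L.
  by rewrite (perm_mem p1) (perm_mem (perm_map fst (perm_map fst pM'))) mem_head.
have {}p1 : perm_eq (unzip1 L) (unzip1 (unzip1 (g :: M''))).
  by apply: (perm_trans p1); exact: (perm_map fst (perm_map fst pM')).
have cD x y : D a b <= c * x -> x <= y -> D a b <= c * y.
  by move=> h xy; apply: (le_trans h); rewrite ler_wpM2l.
have h1 : D a b <= c * (k1 `^ al * w1).
  by apply: (cD _ _ _ D1); apply: ga; rewrite inE b'L orbT.
have h2 : D a b <= c * (k2 `^ al * w2).
  by apply: (cD _ _ _ D2); apply: gb; rewrite inE a'L orbT.
have h3 : D a b <= c * Num.min (k1 `^ al * w1) (k2 `^ al * w2).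
  by rewrite /Num.min; case: ifP.
have k12 : 0 < k1 + k2 by rewrite addr_gt0.
have mono x : 0 < x -> x <= k1 + k2 -> x `^ al <= (k1 + k2) `^ al.
  by move=> x0 xk; apply: ge0_ler_powR => //; rewrite nnegrE ltW.
(* This inequality serves twice: it charges [D a b] to the growth of the potential and, together
   with [D_quad], it makes [g] a valid virtual edge. *)
have merge : k1 `^ al * w1 + k2 `^ al * w2 + D a b <= (k1 + k2) `^ al * (w1 + w2).
  have := @merge_weights _ (k1 `^ al) (k2 `^ al) ((k1 + k2) `^ al) (2 `^ al) w1 w2
    (powR_gt0 _ k1_gt0) (powR_gt0 _ k2_gt0) (mono _ k1_gt0 _) (mono _ k2_gt0 _)
    w1_ge0 w2_ge0 (powR_harmonic_mean al_ge0 k1_gt0 k2_gt0).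
  rewrite -/c lerDl lerDr => /(_ (ltW k2_gt0) (ltW k1_gt0)); lra.
have okg f : f \in g :: M'' -> virtual_ok f.
  rewrite inE => /predU1P[->|/okM''//]; split => //=; first exact: addr_ge0.
  have := D_quad a b a' b'; lra.
move: sumK; rewrite !(perm_big _ pM') !big_cons /= => sumK.
have := IH (g :: M'') p1 p2 gL okg; rewrite !big_cons /= => /(_ _).
have sK : k1 + k2 + \sum_(f <- M'') f.2.1 <= K by lra.
move=> /(_ sK); lra.
Qed.

(** Each edge of [N] starts as a virtual edge made of one original edge. Hence [size N] caps the
    number of original edges in any virtual edge, and the initial potential, being nonnegative, is
    dropped. *)
Lemma greedy_bound (L N : seq (A * B)) :
  perm_eq (unzip1 L) (unzip1 N) -> perm_eq (unzip2 L) (unzip2 N) ->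
  (forall a b, 0 <= D a b) -> greedy D c L ->
  \sum_(e <- L) D e.1 e.2 <=
    2 * (size N)%:R `^ al * \sum_(e <- N) D e.1 e.2.
Proof.
move=> p1 p2 D0 gL.
pose M : seq (A * B * (R * R)) := [seq (e, (1, D e.1 e.2)) | e <- N].
have MN : unzip1 M = N by rewrite /unzip1 -map_comp; exact: map_id.
have ok f : f \in M -> virtual_ok f.
  by move=> /mapP[e _ ->]; split => //=; rewrite powR1 mul1r.
have sK : \sum_(f <- M) f.2.1 <= (size N)%:R.
  by rewrite big_map /= big_const_seq iter_addr_0 count_predT.
have := @greedy_virtual_bound L M _ _ _ gL ok sK; rewrite MN => /(_ p1 p2).
rewrite !big_map /=; apply: le_trans; rewrite lerDl.
by apply: sumr_ge0 => e _; rewrite powR1 mul1r.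
Qed.

End GreedyMatching.

(** * Time-augmented distance and orientation by class *)

Section Instance.
Context (R : realType) (S : metricType R) (m : nat) (I : instance S m).
Implicit Types (e : event R m) (s : schedule R m) (p q r : 'I_m).

Local Notation D := (aug_dist I).
Local Notation arr p := (arrival (I p)).
Local Notation class p := (cls (I p)).

Lemma aug_dist_ge0 p q : 0 <= D p q.
Proof. by rewrite addr_ge0 ?mdist_ge0. Qed.

Lemma aug_distC p q : D p q = D q p.
Proof. by rewrite /aug_dist metric_sym distrC. Qed.

Lemma aug_dist_triangle q p r : D p r <= D p q + D q r.
Proof.
rewrite /aug_dist addrACA lerD ?metric_triangle//.
exact: ler_distD.
Qed.

Lemma aug_dist_quad p q p' q' : D p' q' <= D p' q + D p q + D p q'.
Proof.
rewrite -addrA (le_trans (aug_dist_triangle q _ _))// lerD2l aug_distC.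
by rewrite (le_trans (aug_dist_triangle p _ _))// addrC [D q' p]aug_distC addrC.
Qed.

Lemma mem_all_endpoints s r :
  reflect (exists2 e, e \in s & r \in endpoints e) (r \in all_endpoints s).
Proof. exact: flatten_mapP. Qed.

Lemma size_all_endpoints s : size (all_endpoints s) = (size s).*2.
Proof. by elim: s => //= e s IH; rewrite /all_endpoints /= in IH *; rewrite IH. Qed.

Lemma uniq_endpoints_eq s e e' r : uniq (all_endpoints s) ->
  e \in s -> e' \in s -> r \in endpoints e -> r \in endpoints e' -> e = e'.
Proof.
elim: s => // e0 s IH.
rewrite -[all_endpoints _]/(endpoints e0 ++ all_endpoints s) cat_uniq.
move=> /and3P[_ /hasPn dis u]; rewrite !(in_cons e0).
have no e1 : e1 \in s -> r \in endpoints e0 -> r \in endpoints e1 -> False.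
  move=> e1s re0 re1; have /dis/negP[] // : r \in all_endpoints s.
  by apply/mem_all_endpoints; exists e1.
move=> /predU1P[->|es] /predU1P[->|e's]// re re'; last exact: IH.
- by have := no _ e's re re'.
- by have := no _ es re' re.
Qed.

(** A run puts the later arrival first, whereas comparing two bipartite matchings requires a fixed
    side for each class. *)
Definition oriented e : 'I_m * 'I_m := if class e.1.1 then e.1 else (e.1.2, e.1.1).

Lemma class_oriented e :
  valid_event I e -> class (oriented e).1 /\ ~~ class (oriented e).2.
Proof.
case: e => [[p q] t] /andP[/= + _]; rewrite /oriented /=.
by case cp: (class p); case cq: (class q); rewrite /= ?cp ?cq.
Qed.

(** The filter does not depend on the pairing, so two perfect matchings have the same left vertices
    up to order. *)
Lemma unzip1_oriented s : all (valid_event I) s ->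
  unzip1 (map oriented s) = [seq r <- all_endpoints s | class r].
Proof.
elim: s => //= -[[p q] t] s IH /andP[/andP[/= pq _] /IH ->].
by rewrite /oriented /=; move: pq; do 2!case: (class _).
Qed.

Lemma unzip2_oriented s : all (valid_event I) s ->
  unzip2 (map oriented s) = [seq r <- all_endpoints s | ~~ class r].
Proof.
elim: s => //= -[[p q] t] s IH /andP[/andP[/= pq _] /IH ->].
by rewrite /oriented /=; move: pq; do 2!case: (class _).
Qed.

Lemma count_class s b : all (valid_event I) s ->
  count (fun r => class r == b) (all_endpoints s) = size s.
Proof.
elim: s => //= -[[p q] t] s IH /andP[/andP[/= pq _] /IH ->].
by move: pq; do 2!case: (class _); case: (b).
Qed.

Lemma aug_dist_oriented e : D (oriented e).1 (oriented e).2 = D e.1.1 e.1.2.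
Proof. by rewrite /oriented; case: ifP => // _; rewrite aug_distC. Qed.

Lemma event_cost_ge e : D e.1.1 e.1.2 <= event_cost I e.
Proof.
rewrite /event_cost /aug_dist -addrA lerD2l.
by rewrite [X in _ <= X + _]distrC ler_distD.
Qed.

(** * Cost of triggered events and existence of a run *)

Section Algorithm.
Context (eps : R) (eps_gt0 : 0 < eps).

(** The later request waits [D / eps]; the earlier one waits as long plus the gap between the
    arrivals, and this gap completes the distance to [D]. *)
Lemma triggered_cost s e : triggered I eps s e.2 e.1.1 e.1.2 ->
  event_cost I e = (1 + 2 / eps) * D e.1.1 e.1.2.
Proof.
case: e => [[p q] t] /and5P[_ _ /andP[qp pt] _ /eqP et] /=; rewrite /= in et.
have qt := le_trans qp pt.
rewrite /event_cost /= !ger0_norm ?subr_ge0//.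
rewrite {1}et {1}et /aug_dist ger0_norm ?subr_ge0//; ring.
Qed.

Lemma triggered_valid s e : triggered I eps s e.2 e.1.1 e.1.2 -> valid_event I e.
Proof.
case: e => [[p q] t] /and5P[_ _ /andP[/= qp pt] pq _].
by rewrite /valid_event /= pq ge_max pt (le_trans qp pt).
Qed.

Definition trigger_time (x : 'I_m * 'I_m) : R :=
  arr x.1 + D x.1 x.2 / eps.

Lemma trigger_time_ge x : arr x.1 <= trigger_time x.
Proof. by rewrite lerDl divr_ge0 ?aug_dist_ge0 ?ltW. Qed.

(** Scanning the candidate pairs by increasing trigger time and keeping those with both requests
    still free yields a run. *)
Lemma run_exists : exists s, ALG_B_run I eps s.
Proof.
pose ok (x : 'I_m * 'I_m) := (arr x.2 <= arr x.1) && (class x.1 != class x.2).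
(* The order is decreasing, so that structural induction treats the earliest pairs, at the end of
   the list, first. *)
pose le x y := trigger_time y <= trigger_time x.
pose pairs := sort le [seq x <- enum {: 'I_m * 'I_m} | ok x].
(* A blocking event no later than the trigger time is enough: if the pair is unmatched before that
   time, the event happens exactly then. *)
suff [s [us sin scov]] : exists s, [/\ uniq (all_endpoints s),
    (forall e, e \in s -> e.1 \in pairs /\ e.2 = trigger_time e.1) &
    (forall x, x \in pairs -> exists2 e, e \in s &
       e.2 <= trigger_time x /\ (x.1 \in endpoints e \/ x.2 \in endpoints e))].
  exists s; split => // [[[p q] t] es|t p q].
    have [/=] := sin _ es; rewrite mem_sort mem_filter => /andP[/andP[/= qp pq] _] et.
    have unm r : r \in endpoints (p, q, t) -> unmatched_before s t r.
      move=> re; apply/allP => e' e's; apply/implyP => re'.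
      by rewrite -(uniq_endpoints_eq us es e's re re').
    apply/and5P; split => //=; last exact/eqP.
    - by apply: contraNneq pq => ->.
    - by rewrite !unm ?inE ?eqxx ?orbT.
    - by rewrite qp et; exact: (trigger_time_ge (p, q)).
  move=> /and5P[_ /andP[up uq] /andP[qp pt] pq /eqP et].
  have : (p, q) \in pairs by rewrite mem_sort mem_filter /ok /= qp pq mem_enum.
  move=> /scov[e es [et' pe]]; exists e => //; split => //.
  apply: le_anti; rewrite [X in _ <= X]et et' /=.
  by case: pe => /= re; [move/allP: up|move/allP: uq] => /(_ _ es)/implyP; exact.
have : all (fun x => x.1 != x.2) pairs.
  rewrite all_sort; apply/allP => x; rewrite mem_filter => /andP[/andP[_ xx] _].
  by apply: contraNneq xx => ->.
have : sorted le pairs.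
  by apply: sort_sorted => x y; rewrite /le le_total.
elim: pairs => [_ _|x l IH pl /= /andP[nx nl]]; first by exists [::].
have [||s [us sin scov]] := IH => //; first exact: path_sorted pl.
have min : all (le x) l.
  by apply: order_path_min pl => y z w; rewrite /le => zy wz; exact: le_trans wz zy.
have [|] := boolP ((x.1 \in all_endpoints s) || (x.2 \in all_endpoints s)).
  move=> xs; exists s; split => // [e /sin[el ->]|y].
    by rewrite inE el orbT.
  rewrite inE => /predU1P[->|]; last exact: scov.
  have [e es re] : exists2 e, e \in s & x.1 \in endpoints e \/ x.2 \in endpoints e.
    by case/orP: xs => /mem_all_endpoints[e es re]; exists e => //; [left|right].
  exists e => //; split => //.
  by have [el ->] := sin _ es; exact: (allP min).
rewrite negb_or => /andP[x1s x2s].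
exists ((x, trigger_time x) :: s); split.
- rewrite -[all_endpoints _]/(x.1 :: x.2 :: all_endpoints s) /= in_cons negb_or.
  by rewrite nx x1s x2s us.
- move=> e; rewrite in_cons => /predU1P[->|/sin[el ->]]; first by rewrite mem_head.
  by rewrite in_cons el orbT.
- move=> y; rewrite in_cons => /predU1P[->|/scov[e es ye]].
    exists (x, trigger_time x); first exact: mem_head.
    by rewrite lexx inE eqxx; split => //; left.
  by exists e => //; rewrite in_cons es orbT.
Qed.

(** * Every run is perfect and nearly greedy *)

Section Run.
Context (s : schedule R m) (run : ALG_B_run I eps s).

Lemma run_triggered e : e \in s -> triggered I eps s e.2 e.1.1 e.1.2.
Proof. by case: run => _ + _; exact. Qed.

Lemma run_valid : all (valid_event I) s.
Proof. by apply/allP => e /run_triggered/triggered_valid. Qed.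

(** If neither request is matched by the trigger time, the pair is triggered at that moment and the
    run must match one of the two. *)
Lemma trigger_matched p q : arr q <= arr p -> class p != class q ->
  exists2 e, e \in s &
    e.2 <= trigger_time (p, q) /\ (p \in endpoints e \/ q \in endpoints e).
Proof.
move=> qp pq; case: run => us _ scov.
have [/hasP[e es /andP[epq et]]|/hasPn unm] := boolP (has (fun e : event R m =>
    ((p \in endpoints e) || (q \in endpoints e)) && (e.2 <= trigger_time (p, q))) s).
  by exists e => //; split => //; exact/orP.
have unm' r : (r == p) || (r == q) -> unmatched_before s (trigger_time (p, q)) r.
  move=> rpq; apply/allP => e /unm; rewrite negb_and -ltNge => h.
  apply/implyP => re; apply: ltW; move: h; case: (_ < _) => //; rewrite orbF.
  by case/orP: rpq => /eqP <-; rewrite re ?orbT.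
have [|e es [et pe]] := scov (trigger_time (p, q)) p q; last first.
  by exists e => //; rewrite et.
apply/and5P; split => //; last 1 first.
- by rewrite qp (trigger_time_ge (p, q)).
- by apply: contraNneq pq => ->.
- by rewrite !unm' ?eqxx ?orbT.
Qed.

(** The classes have equal size because [s'] is perfect, and each event uses one request of each. So
    an unmatched request entails unmatched requests of both classes, which contradicts
    [trigger_matched]. *)
Lemma run_perfect s' : admissible I s' -> admissible I s.
Proof.
move=> [ps' vs']; split; last exact: run_valid.
have us : uniq (all_endpoints s) by case: run.
apply: uniq_perm => //; first exact: enum_uniq.
move=> r; rewrite mem_enum inE; apply: contraT => rs.
have unm b : exists2 r', class r' = b & r' \notin all_endpoints s.
  suff : ~~ [forall r', (class r' == b) ==> (r' \in all_endpoints s)].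
    by move=> /forallPn[r']; rewrite negb_imply => /andP[/eqP]; exists r'.
  apply/negP => /forallP all_b.
  have lt_b : (count (fun r' => class r' == class r) (all_endpoints s) <
               count (fun r' => class r' == class r) (enum 'I_m))%N.
    rewrite -!size_filter.
    apply: (@uniq_leq_size _ (r :: [seq _ <- _ | _])) => [|r'].
      by rewrite /= mem_filter (negbTE rs) andbF filter_uniq.
    rewrite in_cons [in X in _ -> X]mem_filter mem_enum andbT => /predU1P[->|].
      exact: eqxx.
    by rewrite mem_filter => /andP[].
  have ge_b : (count (fun r' => class r' == b) (enum 'I_m) <=
               count (fun r' => class r' == b) (all_endpoints s))%N.
    rewrite -!size_filter; apply: uniq_leq_size => [|r']; first exact/filter_uniq/enum_uniq.
    rewrite !mem_filter => /andP[rb _]; rewrite rb /=.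
    exact: (implyP (all_b r')).
  move: lt_b ge_b; rewrite -!(seq.permP ps') !(count_class _ run_valid)
    !(count_class _ vs').
  by move=> h /(leq_trans h); rewrite ltnn.
have [p pb ps] := unm true; have [q qb qs] := unm false.
have contra e x : e \in s -> x \in endpoints e -> x \notin all_endpoints s -> False.
  by move=> es xe /negP[]; apply/mem_all_endpoints; exists e.
have [pq|/ltW pq] := leP (arr p) (arr q).
  have [|e es [_ [] h]] := trigger_matched pq; first by rewrite pb qb.
    by have := contra _ _ es h qs.
  by have := contra _ _ es h ps.
have [|e es [_ [] h]] := trigger_matched pq; first by rewrite pb qb.
  by have := contra _ _ es h ps.
by have := contra _ _ es h qs.
Qed.

(* Otherwise the pair [(r, r')] would have been triggered strictly before the
   moment at which [e] is matched. *)
Lemma run_greedy_event e e' r r' : e \in s -> e' \in s -> e.2 <= e'.2 ->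
  r \in endpoints e -> r' \in endpoints e' -> class r != class r' ->
  D e.1.1 e.1.2 <= (1 + eps) * D r r'.
Proof.
move=> es e's ee' re re' rr'.
have us : uniq (all_endpoints s) by case: run.
(* The only events at [r] and [r'] are [e] and [e'], neither of which precedes [e]. *)
have late e1 : e1 \in s -> r \in endpoints e1 \/ r' \in endpoints e1 -> e.2 <= e1.2.
  move=> e1s [h|h]; first by rewrite (uniq_endpoints_eq us e1s es h re).
  by rewrite (uniq_endpoints_eq us e1s e's h re').
have arrD : arr r' <= arr r + D r r'.
  have : `|arr r - arr r'| <= D r r' by rewrite lerDr mdist_ge0.
  by rewrite ler_norml => /andP[]; lra.
(* The term [D r r'] covers the case where [r'] arrives after [r], in which waiting starts at
   [arr r']. *)
have le_trig : e.2 <= arr r + D r r' + D r r' / eps.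
  have [le_rr'|/ltW le_rr'] := leP (arr r) (arr r').
    have [|e1 e1s [e1t e1r]] := trigger_matched le_rr'; first by rewrite eq_sym.
    apply: (le_trans (late _ e1s _)); first by case: e1r; [right|left].
    by rewrite (le_trans e1t)// /trigger_time /= [D r' r]aug_distC lerD2r.
  have [e1 e1s [e1t e1r]] := trigger_matched le_rr' rr'.
  apply: (le_trans (late _ e1s e1r)); rewrite (le_trans e1t)// /trigger_time /=.
  by rewrite lerD2r lerDl aug_dist_ge0.
have /and5P[_ _ /andP[arr_pq _] _ /eqP et] := run_triggered es.
have arr_r : arr r <= arr e.1.1 by move: re; rewrite !inE => /orP[]/eqP->.
have : D e.1.1 e.1.2 / eps <= D r r' + D r r' / eps by lra.
move=> /(ler_wpM2r (ltW eps_gt0)).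
rewrite [X in _ <= X -> _]mulrDl !divfK ?gt_eqF//; lra.
Qed.

Lemma greedy_oriented (l : schedule R m) :
  sorted (fun e e' : event R m => e.2 <= e'.2) l -> {subset l <= s} ->
  greedy D (1 + eps) (map oriented l).
Proof.
have mem1 e : (oriented e).1 \in endpoints e.
  by rewrite /oriented; case: ifP; rewrite !inE eqxx ?orbT.
have mem2 e : (oriented e).2 \in endpoints e.
  by rewrite /oriented; case: ifP; rewrite !inE eqxx ?orbT.
have cl e e' : e \in s -> e' \in s -> class (oriented e).1 != class (oriented e').2.
  move=> /(allP run_valid)/class_oriented[-> _] /(allP run_valid)/class_oriented[_].
  by case: (class _).
elim: l => // e l IH pl sub.
have es : e \in s by apply: sub; exact: mem_head.
have min e' : e' \in e :: l -> e.2 <= e'.2.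
  rewrite in_cons => /predU1P[->//|].
  apply/(allP (_ : all (fun e' : event R m => e.2 <= e'.2) l)).
  by apply: order_path_min pl => ? ? ?; exact: le_trans.
rewrite /= aug_dist_oriented; split.
- rewrite -[_ :: _]/(unzip2 (map oriented (e :: l))) /unzip2 -map_comp.
  move=> b /mapP[e' e'l ->].
  exact: (run_greedy_event es (sub _ e'l) (min _ e'l) _ _ (cl _ _ es (sub _ e'l))).
- rewrite -[_ :: _]/(unzip1 (map oriented (e :: l))) /unzip1 -map_comp.
  move=> a /mapP[e' e'l ->]; rewrite [D _ (oriented e).2]aug_distC.
  have := cl _ _ (sub _ e'l) es; rewrite eq_sym.
  exact: (run_greedy_event es (sub _ e'l) (min _ e'l)).
- apply: IH (path_sorted pl) _ => x xl.
  by apply: sub; rewrite in_cons xl orbT.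
Qed.

(** * Comparison with an arbitrary perfect matching *)

Lemma run_cost s' : admissible I s' ->
  cost I s <= 4 * (1 / eps * m%:R `^ log2 ((3 + eps) / 2)) * cost I s'.
Proof.
move=> adm'; have [ps' vs'] := adm'; have [ps vs] := run_perfect adm'.
have base_ge1 : 1 <= (3 + eps) / 2 by rewrite ler_pdivlMr//; move: eps_gt0; lra.
set al := log2 _.
have T : (2 : R) `^ al = (3 + eps) / 2.
  by rewrite two_powR_log2// (lt_le_trans _ base_ge1).
have al0 : 0 <= al by exact: log2_ge0.
pose l := sort (fun e e' : event R m => e.2 <= e'.2) s.
have sl : perm_eq l s by rewrite perm_sort.
have vl : all (valid_event I) l by rewrite all_sort.
have pl : perm_eq (all_endpoints l) (all_endpoints s').
  apply: perm_trans (_ : perm_eq _ (all_endpoints s)) _.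
    exact/perm_flatten/perm_map.
  by apply: perm_trans ps _; rewrite perm_sym.
have gl : greedy D (2 * 2 `^ al - 2) (map oriented l).
  (* This equation dictates the exponent [al]. *)
  have -> : 2 * 2 `^ al - 2 = 1 + eps by rewrite T; lra.
  apply: greedy_oriented => [|e]; last by rewrite mem_sort.
  by apply: sort_sorted => x y; exact: le_total.
have p1 : perm_eq (unzip1 (map oriented l)) (unzip1 (map oriented s')).
  by rewrite !unzip1_oriented// perm_filter.
have p2 : perm_eq (unzip2 (map oriented l)) (unzip2 (map oriented s')).
  by rewrite !unzip2_oriented// perm_filter.
have := greedy_bound al0 aug_dist_quad p1 p2 aug_dist_ge0 gl.
rewrite !big_map size_map (perm_big _ sl) /=.
under eq_bigr do rewrite aug_dist_oriented.
under [X in _ <= _ * X]eq_bigr do rewrite aug_dist_oriented.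
(* A perfect matching has [m / 2] edges. The factor gained compensates for [1 + 2 / eps], which is
   not O([1 / eps]) when [eps] is large. *)
have -> : (m%:R : R) `^ al = (3 + eps) / 2 * (size s')%:R `^ al.
  rewrite -T -powRM// -natrM mul2n -size_all_endpoints (perm_size ps').
  by rewrite size_enum_ord.
have -> : cost I s = (1 + 2 / eps) * \sum_(e <- s) D e.1.1 e.1.2.
  rewrite mulr_sumr /cost !big_seq; apply: eq_bigr => e es.
  exact: triggered_cost (run_triggered es).
have D_cost : \sum_(e <- s') D e.1.1 e.1.2 <= cost I s'.
  by apply: ler_sum => e _; exact: event_cost_ge.
have N0 : 0 <= (size s')%:R `^ al :> R by exact: powR_ge0.
have V0 : 0 <= \sum_(e <- s') D e.1.1 e.1.2.
  by apply: sumr_ge0 => e _; exact: aug_dist_ge0.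
move: (\sum_(e <- s) _) (\sum_(e <- s') _) (cost I s') (_ `^ al) D_cost N0 V0.
move=> U V W N VW N0 V0 UV.
have UW : U <= 2 * N * W by apply: (le_trans UV); rewrite ler_wpM2l// mulr_ge0.
have c0 : 0 <= 1 + 2 / eps by rewrite addr_ge0// divr_ge0// ltW.
apply: (le_trans (ler_wpM2l c0 UW)).
have NW : 0 <= N * W by rewrite mulr_ge0// (le_trans V0).
rewrite -subr_ge0.
have -> : 4 * (1 / eps * ((3 + eps) / 2 * N)) * W - (1 + 2 / eps) * (2 * N * W)
    = 2 * eps^-1 * (N * W).
  by field; rewrite gt_eqF.
by rewrite mulr_ge0// mulr_ge0// invr_ge0 ltW.
Qed.

End Run.
End Algorithm.
End Instance.

Theorem theorem11 (R : realType) :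
  exists2 C : R, 0 < C &
    forall (S : metricType R) (eps : R), 0 < eps ->
      competitive (ALG_B S eps)
        (fun m : nat => C * (1 / eps * m%:R `^ log2 ((3 + eps) / 2))).
Proof.
exists 4 => // S eps eps_gt0 m I [s0 adm0]; split; first exact: run_exists.
move=> s run; split; first exact: (run_perfect eps_gt0 run adm0).
have bound := run_cost eps_gt0 run; rewrite /=; set alpha := (4 * _) in bound *.
have : 0 <= alpha by rewrite /alpha mulr_ge0// mulr_ge0 ?powR_ge0// divr_ge0// ltW.
(* [alpha] vanishes when [m = 0], and there the bound already makes the cost nonpositive. Otherwise,
   dividing by [alpha] turns the bound into a lower bound of the set whose infimum is [OPT]. *)
rewrite le_eqVlt => /predU1P[alpha0|alpha_gt0].
  by have := bound _ adm0; rewrite -alpha0 !mul0r.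
rewrite mulrC -ler_pdivrMr//; apply: lb_le_inf; first by exists (cost I s0), s0.
by move=> _ [s' /bound h <-]; rewrite ler_pdivrMr// mulrC.
Qed.
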